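(* Let $(K,\Delta)$ be a Hermitian form field, let $n\geq 3$ and $G=U_{2n+1}(K,\Delta)$. Let $\mathcal{C}$ denote the set of all conjugacy classes of $G$ of level $(K,\Delta)$ and let $S_{\mathrm{extra}}$ denote the set of all nontrivial extra short root transvections in $G$. Then $\mathrm{scn}_{\mathcal{C}}(S_{\mathrm{extra}})\leq 12$.
   Context: Hermitian form fields. A Hermitian form field $(K,\Delta)$ consists of the following data. $K$ is a (commutative) field with a ring automorphism $x\mapsto\bar x$, an element $\lambda\in K$ with $\bar{\bar x}=\lambda x\bar\lambda$ for all $x\in K$ (hence $\bar\lambda=\lambda^{-1}$), and an element $\mu\in K$ with $\mu=\bar\mu\lambda$. The Heisenberg group $\mathfrak{H}$ is the set $K\times K$ with group operation $(x_1,y_1)\dot{+}(x_2,y_2)=(x_1+x_2,\,y_1+y_2-\bar x_1\mu x_2)$; the inverse of $(x,y)$ is $\dot{-}(x,y)=(-x,-y-\bar x\mu x)$, and $a\dot{-}b$ means $a\dot{+}(\dot{-}b)$. For $a\in K$ put $(x,y)\circ a=(xa,\bar a y a)$. A subgroup of $\mathfrak{H}$ stable under $\circ a$ for all $a\in K$ is called a $K^\bullet$-submodule. For $A\subseteq\mathfrak H$, $B\subseteq K$, $A\circ B$ denotes the subgroup of $\mathfrak H$ generated by all $a\circ b$, $a\in A,b\in B$. Put $\mathrm{tr}(x,y)=\bar x\mu x+y+\bar y\lambda$, $\Delta_{\min}=\{(0,x-\bar x\lambda)\mid x\in K\}$ and $\Delta_{\max}=\{(x,y)\in\mathfrak H\mid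 \mathrm{tr}(x,y)=0\}$. $\Delta$ is a $K^\bullet$-submodule of $\mathfrak H$ with $\Delta_{\min}\subseteq\Delta\subseteq\Delta_{\max}$. Odd form ideals. Put $J(\Delta)=\{y\in K\mid \exists z\in K: (y,z)\in\Delta\}$. For an ideal $I$ of $K$ with $\bar x\in I$ for all $x\in I$, put $\tilde I=\{x\in K\mid \overline{J(\Delta)}\mu x\subseteq I\}$, $\Omega^I_{\min}=\{(0,x-\bar x\lambda)\mid x\in I\}\dot{+}\Delta\circ I$ and $\Omega^I_{\max}=\Delta\cap(\tilde I\times I)$. An odd form ideal of $(K,\Delta)$ is a pair $(I,\Omega)$ where $I$ is an ideal of $K$ with $\bar x\in I$ for all $x\in I$ and $\Omega$ is a $K^\bullet$-submodule of $\mathfrak H$ with $\Omega^I_{\min}\subseteq\Omega\subseteq\Omega^I_{\max}$. The unitary group. Let $M=K^{2n+1}$ (column vectors) with standard basis indexed $(e_1,\dots,e_n,e_0,e_{-n},\dots,e_{-1})$; rows and columns of $(2n+1)\times(2n+1)$ matrices are indexed in the same way. Define $B(u,v)=\sum_{i=1}^n\bar u_iv_{-i}+\bar u_0\mu v_0+\sum_{i=-n}^{-1}\bar u_i\lambda v_{-i}$ and $Q(u)=(u_0,\sum_{i=1}^n\bar u_iu_{-i})\in\mathfrak H$. Then $U_{2n+1}(K,\Delta)$ is the group of all $\sigma\in GL_{2n+1}(K)$ with $B(\sigma u,\sigma v)=B(u,v)$ and $Q(\sigma u)\dot{-}Q(u)\in\Delta$ for all $u,v\in M$. Transvections. Let $\Theta_{\mathrm{hb}}=\{\pm1,\dots,\pm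 n\}$, $\epsilon(i)=1$ if $i>0$ and $\epsilon(i)=-1$ if $i<0$. Let $e$ be the identity matrix and $e^{ij}$ the matrix units. Short root transvections are the matrices $T_{ij}(x)=e+xe^{ij}-\lambda^{(\epsilon(j)-1)/2}\bar x\lambda^{(1-\epsilon(i))/2}e^{-j,-i}$ with $i,j\in\Theta_{\mathrm{hb}}$, $i\neq\pm j$, $x\in K$. For a subset $\Omega\subseteq K\times K$ put $\Omega^{1}=\Omega$ and $\Omega^{-1}=\{(x,y)\mid (x,\bar y)\in\Omega\}$. Extra short root transvections are the matrices $T_i(x,y)=e+xe^{0,-i}-\lambda^{-(1+\epsilon(i))/2}\bar x\mu e^{i0}+ye^{i,-i}$ with $i\in\Theta_{\mathrm{hb}}$, $(x,y)\in\Delta^{-\epsilon(i)}$. All these lie in $U_{2n+1}(K,\Delta)$; nontrivial means different from $e$. $E=EU_{2n+1}(K,\Delta)$ is the subgroup generated by all short and extra short root transvections. Relative subgroups. Let $(I,\Omega)$ be an odd form ideal. $T_{ij}(x)$ is $(I,\Omega)$-elementary if $x\in I$; $T_i(x,y)$ is $(I,\Omega)$-elementary if $(x,y)\in\Omega^{-\epsilon(i)}$. $EU_{2n+1}((K,\Delta),(I,\Omega))$ is the normal closure in $E$ of the subgroup generated by all $(I,\Omega)$-elementary transvections. $U_{2n+1}((K,\Delta),(I,\Omega))$ is the subgroup of all $\sigma\in U_{2n+1}(K,\Delta)$ with $\sigma_{ij}-\delta_{ij}\in I$ for all $i,j\in\Theta_{\mathrm{hb}}$ and $Q(\sigma u)\dot{-}Q(u)\in\Omega$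 for all $u\in M$ with $u_0\in J(\Delta)$. $NU_{2n+1}((K,\Delta),(I,\Omega))$ is its normaliser in $U_{2n+1}(K,\Delta)$, and $CU_{2n+1}((K,\Delta),(I,\Omega))=\{\sigma\in NU_{2n+1}((K,\Delta),(I,\Omega))\mid [\sigma,E]\leq U_{2n+1}((K,\Delta),(I,\Omega))\}$. Level. Let $n\geq3$. It is known (Bak–Preusser) that for every subgroup $H$ of $U_{2n+1}(K,\Delta)$ normalised by $E$ there is a unique odd form ideal $(I,\Omega)$ with $EU_{2n+1}((K,\Delta),(I,\Omega))\subseteq H\subseteq CU_{2n+1}((K,\Delta),(I,\Omega))$; it is called the level of $H$. The level of a conjugacy class $C$ of $G=U_{2n+1}(K,\Delta)$ is the level of the subgroup generated by $C$. Covering numbers. For a group $G$ and subsets $S,X\subseteq G$, $\mathrm{cn}_X(S)$ is the least positive integer $m$ with $S\subseteq X^m=\{x_1\cdots x_m\mid x_i\in X\}$ ($\infty$ if there is none), and $\mathrm{scn}_X(S)=\mathrm{cn}_{X\cup X^{-1}}(S)$. For a set $\mathcal X$ of subsets of $G$, $\mathrm{scn}_{\mathcal X}(S)=\sup\{\mathrm{scn}_X(S)\mid X\in\mathcal X\}$. *)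

(* Defs.v *)
From HB Require Import structures.
From mathcomp Require Import all_boot all_order all_algebra.
From mathcomp Require Import boolp classical_sets constructive_ereal.
From mathcomp Require Import ring.

Set Implicit Arguments.
Unset Strict Implicit.
Unset Printing Implicit Defensive.

Import Order.TTheory GRing.Theory Num.Theory.
Local Open Scope classical_set_scope.
Local Open Scope ring_scope.

Section Groups.
Variable gT : groupType.
Implicit Types (A B C G N S X : set gT) (x g : gT).
Local Open Scope group_scope.

Definition subgroup A : Prop :=
  [/\ A 1, forall x y, A x -> A y -> A (x * y) & forall x, A x -> A x^-1].

Definition generated A : set gT := smallest subgroup A.

Definition normal_subgroup G N : Prop :=
  [/\ subgroup N, N `<=` G & forall x g, N x -> G g -> N (x ^ g)].

Definition normal_closure G A : set gT := smallest (normal_subgroup G) A.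

Definition normaliser G A : set gT :=
  [set g | G g /\ [set x ^ g | x in A] = A].

Definition conj_classes G : set (set gT) :=
  [set [set x ^ g | g in G] | x in G].

Definition set_power X (m : nat) : set gT :=
  [set \prod_(i < m) x i | x in [set x : 'I_m -> gT | forall i, X (x i)]].

(* Covering numbers live in the extended integers; +oo is also the value of
   the infimum of the empty set. *)
Definition cn X S : \bar int :=
  infimum +oo%E [set (Posz m)%:E | m in
    [set m : nat | (0 < m)%N /\ S `<=` set_power X m]].

Definition scn X S : \bar int := cn (X `|` [set x^-1 | x in X]) S.

Definition scn_sup (XX : set (set gT)) S : \bar int :=
  supremum -oo%E [set scn X S | X in XX].

End Groups.

(* unit_group 'M[K]_m.+1 is GL_(m.+1)(K), for an arbitrary field K. *)
Record unit_group (R : unitRingType) :=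
  UnitGroup { ug_val :> R; ug_valP : ug_val \is a GRing.unit }.

Section UnitGroup.
Variable R : unitRingType.
Implicit Types x y : unit_group R.

HB.instance Definition _ := [isSub for @ug_val R].
HB.instance Definition _ := [Choice of unit_group R by <:].

Lemma ug_mul_unit x y : ug_val x * ug_val y \is a GRing.unit.
Proof. by rewrite unitrMl ?ug_valP. Qed.

Lemma ug_inv_unit x : (ug_val x)^-1 \is a GRing.unit.
Proof. by rewrite unitrV ug_valP. Qed.

Definition ug_one := UnitGroup (unitr1 R).
Definition ug_mul x y := UnitGroup (ug_mul_unit x y).
Definition ug_inv x := UnitGroup (ug_inv_unit x).

Lemma ug_mulA : associative ug_mul.
Proof. by move=> x y z; apply: val_inj; rewrite /= mulrA. Qed.

Lemma ug_mul1 : left_id ug_one ug_mul.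
Proof. by move=> x; apply: val_inj; rewrite /= mul1r. Qed.

Lemma ug_mulr1 : right_id ug_one ug_mul.
Proof. by move=> x; apply: val_inj; rewrite /= mulr1. Qed.

Lemma ug_mulV : left_inverse ug_one ug_inv ug_mul.
Proof. by move=> x; apply: val_inj; rewrite /= mulVr ?ug_valP. Qed.

Lemma ug_mulrV : right_inverse ug_one ug_inv ug_mul.
Proof. by move=> x; apply: val_inj; rewrite /= mulrV ?ug_valP. Qed.

HB.instance Definition _ :=
  isGroup.Build (unit_group R) ug_mulA ug_mul1 ug_mulr1 ug_mulV ug_mulrV.

End UnitGroup.

Record hermParam (K : fieldType) := HermParam {
  bar : {rmorphism K -> K};
  bar_bij : bijective bar;
  lam : K;
  mu : K;
  bar_bar : forall x, bar (bar x) = lam * x * bar lam;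
  mu_bar : mu = bar mu * lam }.

(* The Heisenberg group.  Its operation, written additively with a dot in the
   mathematics, is the groupType operation (x * y, x / y in %g). *)
Definition heis (K : fieldType) (h : hermParam K) : Type := (K * K)%type.

Section Heisenberg.
Variables (K : fieldType) (h : hermParam K).
Local Notation "x ^b" := (bar h x) (at level 2, format "x ^b").
Local Notation l := (lam h).
Local Notation m := (mu h).
Implicit Types (p q : heis h) (A : set (heis h)).

HB.instance Definition _ := Choice.copy (heis h) (K * K)%type.

Definition heis_one : heis h := (0, 0).
Definition heis_mul p q : heis h := (p.1 + q.1, p.2 + q.2 - p.1^b * m * q.1).
Definition heis_inv p : heis h := (- p.1, - p.2 - p.1^b * m * p.1).

Lemma heis_mulA : associative heis_mul.
Proof.
move=> [a b] [c d] [x y]; congr (_, _); first exact: addrA.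
by rewrite /= rmorphD; ring.
Qed.

Lemma heis_mul1 : left_id heis_one heis_mul.
Proof.
by move=> [a b]; rewrite /heis_mul /= !add0r rmorph0 !mul0r subr0.
Qed.

Lemma heis_mulr1 : right_id heis_one heis_mul.
Proof. by move=> [a b]; rewrite /heis_mul /= !addr0 mulr0 subr0. Qed.

Lemma heis_mulV : left_inverse heis_one heis_inv heis_mul.
Proof.
move=> [a b]; rewrite /heis_mul /heis_inv /= addNr; congr (_, _).
by rewrite rmorphN !mulNr opprK addrAC addrNK addNr.
Qed.

Lemma heis_mulrV : right_inverse heis_one heis_inv heis_mul.
Proof.
move=> [a b]; rewrite /heis_mul /heis_inv /= addrN; congr (_, _).
by rewrite mulrN opprK addrA addrNK addrN.
Qed.

HB.instance Definition _ :=
  isGroup.Build (heis h) heis_mulA heis_mul1 heis_mulr1 heis_mulV heis_mulrV.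

Definition heis_act p (a : K) : heis h := (p.1 * a, a^b * p.2 * a).

Definition Kmodule A : Prop :=
  subgroup A /\ forall p a, A p -> A (heis_act p a).

Definition heis_gen A (B : set K) : set (heis h) :=
  generated [set heis_act p b | p in A & b in B].

Definition heis_tr p : K := p.1^b * m * p.1 + p.2 + p.2^b * l.

Definition Delta_min : set (heis h) := [set (0, x - x^b * l) | x in setT].
Definition Delta_max : set (heis h) := [set p | heis_tr p = 0].

(* Omega ^ e for a sign e = 1 or e = -1. *)
Definition heis_signed A (e : int) : set (heis h) :=
  if e == 1 then A else [set p | A (p.1, p.2^b)].

End Heisenberg.

Arguments Delta_min {K} h.
Arguments Delta_max {K} h.

Record hermFormField (K : fieldType) := HermFormField {
  hparam :> hermParam K;
  Delta : set (heis hparam);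
  Delta_Kmodule : Kmodule Delta;
  Delta_lower : Delta_min hparam `<=` Delta;
  Delta_upper : Delta `<=` Delta_max hparam }.

Arguments Delta {K} _.

Section OddFormIdeals.
Variables (K : fieldType) (H : hermFormField K).
Local Notation "x ^b" := (bar H x) (at level 2, format "x ^b").
Local Notation l := (lam H).
Local Notation m := (mu H).
Implicit Types (I : set K) (Om : set (heis H)).

Definition is_ideal I : Prop :=
  [/\ I 0, forall x y, I x -> I y -> I (x + y) & forall a x, I x -> I (a * x)].

Definition J_Delta : set K := [set y | exists z, Delta H (y, z)].

Definition tilde I : set K := [set x | forall y, J_Delta y -> I (y^b * m * x)].

Definition Omega_min I : set (heis H) :=
  [set (p * q)%g | p in [set ((0, x - x^b * l) : heis H) | x in I]
                 & q in heis_gen (Delta H) I].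

Definition Omega_max I : set (heis H) :=
  Delta H `&` [set p | tilde I p.1 /\ I p.2].

Definition odd_form_ideal I Om : Prop :=
  [/\ is_ideal I, forall x, I x -> I x^b, Kmodule Om,
      Omega_min I `<=` Om & Om `<=` Omega_max I].

End OddFormIdeals.

(* The index set (1, ..., n, 0, -n, ..., -1) is encoded by positions: index
   i > 0 is i - 1, index 0 is n and index -i is 2n - (i - 1), so that
   index negation is rev_ord. *)
Notation hindex n := 'I_(n.*2.+1).

Section Unitary.
Variables (K : fieldType) (H : hermFormField K) (n : nat).
Local Notation "x ^b" := (bar H x) (at level 2, format "x ^b").
Local Notation l := (lam H).
Local Notation m := (mu H).
Local Notation GL := (unit_group 'M[K]_(n.*2.+1)).
Implicit Types (i j : hindex n) (u v : 'cV[K]_(n.*2.+1)) (g : GL).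
Implicit Types (I : set K) (Om : set (heis H)).

Definition ind0 : hindex n := inord n.
Definition ind_opp i : hindex n := rev_ord i.
Definition ind_hb i : bool := i != ind0.
Definition eps i : int := if (i < n)%N then 1 else -1.

Definition formB u v : K :=
  \sum_(i : hindex n | (i < n)%N) (u i 0)^b * v (ind_opp i) 0
  + (u ind0 0)^b * m * v ind0 0
  + \sum_(i : hindex n | (n < i)%N) (u i 0)^b * l * v (ind_opp i) 0.

Definition formQ u : heis H :=
  (u ind0 0, \sum_(i : hindex n | (i < n)%N) (u i 0)^b * u (ind_opp i) 0).

Definition unitary : set GL :=
  [set g | (forall u v, formB (val g *m u) (val g *m v) = formB u v) /\
           (forall u, Delta H (formQ (val g *m u) / formQ u)%g)].

Definition short_root i j (x : K) : 'M[K]_(n.*2.+1) :=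
  1%:M + x *: delta_mx i j
  - (l ^ ((eps j - 1) %/ 2)%Z * x^b * l ^ ((1 - eps i) %/ 2)%Z)
      *: delta_mx (ind_opp j) (ind_opp i).

Definition extra_short_root i (x y : K) : 'M[K]_(n.*2.+1) :=
  1%:M + x *: delta_mx ind0 (ind_opp i)
  - (l ^ (- ((1 + eps i) %/ 2)%Z) * x^b * m) *: delta_mx i ind0
  + y *: delta_mx i (ind_opp i).

(* The (I, Om)-elementary transvections of the two kinds; for I = K and
   Om = Delta these are all of them. *)
Definition short_transvections I : set GL :=
  [set g | exists i j x,
    [/\ [&& ind_hb i, ind_hb j, i != j & i != ind_opp j], I x &
        val g = short_root i j x]].

Definition extra_short_transvections Om : set GL :=
  [set g | exists i x y, [/\ ind_hb i, heis_signed Om (- eps i) (x, y) &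
                             val g = extra_short_root i x y]].

Definition elementary_transvections I Om : set GL :=
  short_transvections I `|` extra_short_transvections Om.

Definition EU : set GL := generated (elementary_transvections setT (Delta H)).

Definition EU_rel I Om : set GL :=
  normal_closure EU (generated (elementary_transvections I Om)).

Definition U_rel I Om : set GL :=
  [set g | [/\ unitary g,
    forall i j, ind_hb i -> ind_hb j -> I (val g i j - (i == j)%:R) &
    forall u, J_Delta H (u ind0 0) -> Om (formQ (val g *m u) / formQ u)%g]].

Definition NU_rel I Om : set GL := normaliser unitary (U_rel I Om).

Definition CU_rel I Om : set GL :=
  NU_rel I Om `&`
  [set g | generated [set [~ g, t]%g | t in EU] `<=` U_rel I Om].

(* For n >= 3 a subgroup of unitary normalised by EU has exactly one level
   (Bak-Preusser), so "the level of N is (I, Om)" is a relation. *)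
Definition has_level (N : set GL) I Om : Prop :=
  [/\ odd_form_ideal I Om, EU_rel I Om `<=` N & N `<=` CU_rel I Om].

Definition classes_of_level I Om : set (set GL) :=
  [set C | conj_classes unitary C /\ has_level (generated C) I Om].

Definition S_extra : set GL :=
  [set g | extra_short_transvections (Delta H) g /\ g != 1%g].

End Unitary.

Arguments unitary {K} H n.
Arguments EU {K} H n.
Arguments EU_rel {K H} n I Om.
Arguments U_rel {K H} n I Om.
Arguments NU_rel {K H} n I Om.
Arguments CU_rel {K H} n I Om.
Arguments classes_of_level {K H} n I Om.
Arguments S_extra {K} H n.

(* Main.v *)
Require Import Defs.
From mathcomp Require Import all_boot all_order all_algebra.
From mathcomp Require Import boolp classical_sets constructive_ereal.
From mathcomp Require Import ring zify.
Import Defs.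

(** Call a vector [u] singular when [Q u] lies in [Delta].  For orthogonal
    singular vectors [v] and [d] the map
    [w |-> w + v B(d, w) - lambda^-1 d B(v, w)] is unitary; it is written
    [trans v d] below, and the short root transvections are of this form.
    Let [X] be a class of level [(K, Delta)] together with the inverses of its
    elements.  Whenever [v] and [d] are independent modulo the radical of [B],
    [trans v d] is a product of four elements of [X].  Every extra short root
    transvection is a product of three such [trans v d], one of which may
    degenerate to the identity [x x^-1 x x^-1].  Hence the bound 3 * 4 = 12.

    Three for the extra short ones ([extra_power12]).  The unipotent maps that
    fix [d] and move its orthogonal space by multiples of [d] form a
    Heisenberg-like group, in which an extra short root transvection lies over
    the vector [x e_0].  If [(x, z)] is in [Delta], then [s = x e_0 + e_k + z e_-k]
    is singular, and [s - e_k - z e_-k = x e_0] writes this transvection as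
    [trans s d * trans (- e_k) d * trans (- z e_-k) d]; the central part comes
    out right because [B] pairs [e_k] with [z e_-k].

    Four for the others ([trans_power4]).  A class of level [(K, Delta)]
    contains an [r] that does not fix all the lines spanned by hyperbolic basis
    vectors modulo the radical ([exists_offdiagonal]): the elements that fix
    these lines form a subgroup that omits a short root transvection.  For basis
    vectors [u], [v] with [t = trans u v], the element [r t r^-1 t^-1] is a
    product of two elements of [X], and its commutator with [t' = trans c d] is a
    product of four.  When [t'] commutes with [t], that commutator is also the
    commutator of [r t r^-1 = trans (r u) (r v)] with [t'].  If moreover [d] is
    orthogonal to [r u] and [r v], this is a single transvection [trans a' d]
    ([trans_commutator]).  Choose [u], [v] and [c] in a three-dimensional totally
    singular space such that [c] is not orthogonal to [r u]; a count of
    dimensions in this space yields such a [d] that is independent of [a']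
    ([exists_orth_indep]).  Finally all transvections [trans v d] with [v], [d]
    independent modulo the radical are conjugate, because the unitary group is
    transitive on these pairs ([sing_pair_to_base]):
    the quasi-reflection along [v - u] carries [u] to [v] if [B(u, v)] is
    nonzero, and a third singular vector serves as an intermediate stop if it
    is zero. *)

Set Implicit Arguments.
Unset Strict Implicit.
Unset Printing Implicit Defensive.

Import Order.TTheory GRing.Theory Num.Theory.
Local Open Scope classical_set_scope.
Local Open Scope ring_scope.

(** * Covering numbers *)

Section CoveringNumbers.
Variable gT : groupType.
Implicit Types (A G S X : set gT) (x y g : gT) (a b m : nat).
Local Open Scope group_scope.

Definition symm X : set gT := X `|` [set x^-1 | x in X].

Lemma set_power1 X x : X x -> set_power X 1 x.
Proof. by move=> Xx; exists (fun=> x); rewrite //= big_ord1. Qed.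

Lemma set_powerD X a b x y :
  set_power X a x -> set_power X b y -> set_power X (a + b) (x * y).
Proof.
move=> [f Xf <-] [g Xg <-].
exists (fun i => match split i with inl j => f j | inr j => g j end).
  by move=> i; case: (split i).
rewrite big_split_ord /=; congr (_ * _).
  apply: eq_bigr => i _; case: (splitP (lshift b i)) => j /= eq_ij.
    by congr (f _); apply: val_inj.
  by have := ltn_ord i; rewrite eq_ij ltnNge leq_addr.
apply: eq_bigr => i _; case: (splitP (rshift a i)) => j /= eq_ij.
  by have := ltn_ord j; rewrite -eq_ij ltnNge leq_addr.
by congr (g _); apply/val_inj/(@addnI a).
Qed.

(** Exponents are exact, so an identity factor has to be padded out as
    [x x^-1 x x^-1]. *)
Lemma set_power4_1 X x : X x -> X x^-1 -> set_power X 4 1.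
Proof.
move=> Xx XVx; rewrite -[1]mulg1 -(mulgV x).
by apply: (@set_powerD X 2 2); apply: (@set_powerD X 1 1); apply: set_power1.
Qed.

Lemma set_power_conj X m x g :
  (forall y, X y -> X (y ^ g)) -> set_power X m x -> set_power X m (x ^ g).
Proof.
move=> Xg [f Xf <-]; exists (fun i => f i ^ g); first by move=> i; exact: Xg.
by rewrite conjg_prod.
Qed.

(** Conjugation by [s t s^-1 t^-1] and by [s t s^-1] agree on [r], since [t]
    commutes with [r]; the left-hand side is therefore the commutator of
    [s t s^-1 t^-1] with [r], in which [s] occurs four times. *)
Lemma double_commutator_power4 X s t r :
    (forall x, X x -> X x^-1) -> (forall x, X x -> X (x ^ t^-1)) ->
    (forall x, X x -> X (x ^ r^-1)) -> commute t r -> X s ->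
  set_power X 4 ((s * t * s^-1) * r * (s * t * s^-1)^-1 * r^-1).
Proof.
move=> XV Xt Xr tr Xs.
have -> : (s * t * s^-1) * r * (s * t * s^-1)^-1 * r^-1
    = s * (s^-1 ^ t^-1) * ((s ^ t^-1) ^ r^-1 * (s^-1 ^ r^-1)).
  rewrite !conjgE !invgK !invgM !invgK !mulgA !mulgVK.
  by rewrite -[_ * t^-1 * r]mulgA -commuteV // mulgA mulgVK.
apply: (@set_powerD X 2 2); apply: (@set_powerD X 1 1); apply: set_power1; auto.
Qed.

(** The covering number is at most [m] because a least exponent exists among
    the positive integers; the supremum needs no such argument, as its default
    value is [-oo]. *)
Lemma scn_sup_le (XX : set (set gT)) S m :
  (0 < m)%N -> (forall X, XX X -> S `<=` set_power (symm X) m) ->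
  (scn_sup XX S <= (Posz m)%:E)%E.
Proof.
move=> m_gt0 cover; have scn_le X : XX X -> (scn X S <= (Posz m)%:E)%E.
  move=> /cover SXm; rewrite /scn /cn.
  pose P k := `[< (0 < k)%N /\ S `<=` set_power (symm X) k >].
  have Pm : exists k, P k by exists m; apply/asboolP.
  apply: le_infimum_Nmem; last by exists m.
  exists (Posz (ex_minn Pm))%:E; case: ex_minnP => k /asboolP Pk k_min.
  split; first move=> _ [j Pj <-].
    by rewrite lee_fin lez_nat k_min //; apply/asboolP.
  by move=> z; apply; exists k.
rewrite /scn_sup /supremum; case: eqP => [_|_]; first exact: leNye.
case: xgetP => [z -> [_ z_min]|_]; last exact: leNye.
by apply: z_min => _ [X /scn_le leX <-].
Qed.

End CoveringNumbers.

Section Unitary.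
Variables (K : fieldType) (H : hermFormField K) (n : nat).
Local Notation "x ^b" := (bar H x) (at level 2, format "x ^b").
Local Notation l := (lam H).
Local Notation m := (mu H).
Local Notation vect := 'cV[K]_(n.*2.+1).
Local Notation mat := 'M[K]_(n.*2.+1).
Local Notation GL := (unit_group mat).
Local Notation "0i" := (ind0 n) (at level 0).
Local Notation opp := (@ind_opp n).
Local Notation B := (formB H).
Local Notation Q := (formQ H).
Local Notation U := (unitary H n).
Local Notation sb k := (delta_mx k 0 : vect).
Implicit Types (i j k : 'I_(n.*2.+1)) (u v w a c d : vect) (g h : GL).
Implicit Types (x y z : K).

(** * The form *)

Lemma lam_barM : l * l^b = 1.
Proof. by have := bar_bar H 1; rewrite !rmorph1 mulr1. Qed.

Lemma lam_neq0 : l != 0.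
Proof. by apply: contra_eqN lam_barM => /eqP ->; rewrite mul0r eq_sym oner_eq0. Qed.

Lemma bar_lam : l^b = l^-1.
Proof. by rewrite -[LHS](mulKf lam_neq0) lam_barM mulr1. Qed.

Lemma barK : involutive (bar H).
Proof. by move=> x; rewrite bar_bar mulrAC lam_barM mul1r. Qed.

Lemma bar_eq0 x : (x^b == 0) = (x == 0).
Proof. exact: fmorph_eq0. Qed.

Lemma bar_mu : m^b = m * l^-1.
Proof. by rewrite {2}(mu_bar H) mulfK ?lam_neq0. Qed.

Lemma val_ind0 : 0i = n :> nat.
Proof. by rewrite inordK // -addnn ltnS leq_addr. Qed.

Lemma ind_oppK : involutive (opp).
Proof. exact: rev_ordK. Qed.

Lemma val_opp i : (opp i : nat) = (n.*2 - i)%N.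
Proof. by rewrite /ind_opp /= subSS. Qed.

Lemma ind_opp0 : opp 0i = 0i.
Proof. by apply: val_inj; rewrite /= val_ind0; lia. Qed.

Lemma ind_hbE i : ind_hb i = ((i < n) || (n < i))%N.
Proof. by rewrite /ind_hb -val_eqE /= val_ind0 neq_ltn. Qed.

Lemma ind_hb_opp i : ind_hb (opp i) = ind_hb i.
Proof. by rewrite !ind_hbE val_opp; have := ltn_ord i; lia. Qed.

Lemma opp_gt i : (n < opp i)%N = (i < n)%N.
Proof. by rewrite val_opp; have := ltn_ord i; lia. Qed.

Lemma opp_lt i : (opp i < n)%N = (n < i)%N.
Proof. by rewrite val_opp; have := ltn_ord i; lia. Qed.

Lemma opp_neq i : ind_hb i -> opp i != i.
Proof. by rewrite ind_hbE -val_eqE /= subSS; have := ltn_ord i; lia. Qed.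

Lemma opp_eq i j : (opp i == j) = (i == opp j).
Proof. by rewrite (can2_eq ind_oppK ind_oppK). Qed.

(** The Gram coefficient [B(e_i, e_-i)], which merges the three sums in the
    definition of the form into one. *)
Definition chi i : K := if (i < n)%N then 1 else if (n < i)%N then l else m.

Lemma chi_opp i : chi (opp i) = (chi i)^b * l.
Proof.
rewrite /chi opp_lt opp_gt; case: (ltngtP i n) => _.
- by rewrite rmorph1 mul1r.
- by rewrite bar_lam mulVf ?lam_neq0.
- exact: mu_bar.
Qed.

Lemma chi_neq0 i : ind_hb i -> chi i != 0.
Proof.
by rewrite ind_hbE /chi; case: ltngtP; rewrite ?oner_neq0 ?lam_neq0.
Qed.

Lemma sum_indexE (F : 'I_(n.*2.+1) -> K) :
  \sum_i F i = \sum_(i : 'I_(n.*2.+1) | (i < n)%N) F i + F 0i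
    + \sum_(i : 'I_(n.*2.+1) | (n < i)%N) F i.
Proof.
rewrite (bigID (fun i : 'I_(n.*2.+1) => (i < n)%N)) /= -addrA; congr (_ + _).
rewrite (bigD1 0i) ?val_ind0 ?ltnn //=; congr (_ + _); apply: eq_bigl => i.
by rewrite -val_eqE /= val_ind0; lia.
Qed.

Lemma formBE u v : B u v = \sum_i (u i 0)^b * chi i * v (opp i) 0.
Proof.
rewrite sum_indexE /formB ind_opp0 /chi val_ind0 !ltnn.
congr (_ + _ + _); apply: eq_bigr => i lt_in; first by rewrite lt_in mulr1.
by rewrite lt_in ltnNge ltnW.
Qed.

Lemma formBDr u v w : B u (v + w) = B u v + B u w.
Proof.
by rewrite !formBE -big_split; apply: eq_bigr => i _; rewrite !mxE mulrDr.
Qed.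

Lemma formBZr u x v : B u (x *: v) = x * B u v.
Proof.
by rewrite !formBE mulr_sumr; apply: eq_bigr => i _; rewrite !mxE mulrCA.
Qed.

(** Reindexing by [i |-> -i] turns hermitian symmetry into [chi_opp]. *)
Lemma formBC u v : B v u = (B u v)^b * l.
Proof.
rewrite !formBE rmorph_sum mulr_suml (reindex_inj (can_inj ind_oppK)) /=.
apply: eq_bigr => i _; rewrite ind_oppK chi_opp !rmorphM barK; ring.
Qed.

Lemma formBDl u v w : B (u + v) w = B u w + B v w.
Proof. by rewrite formBC formBDr rmorphD mulrDl -!formBC. Qed.

Lemma formBZl u x v : B (x *: u) v = x^b * B u v.
Proof. by rewrite formBC formBZr rmorphM -mulrA -formBC. Qed.

Lemma formBNr u v : B u (- v) = - B u v.
Proof. by rewrite -scaleN1r formBZr mulN1r. Qed.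

Lemma formBNl u v : B (- u) v = - B u v.
Proof. by rewrite -scaleN1r formBZl rmorphN1 mulN1r. Qed.

Lemma formB0r u : B u 0 = 0.
Proof. by rewrite -[0 in LHS](scale0r (0 : vect)) formBZr mul0r. Qed.

Lemma formB0l u : B 0 u = 0.
Proof. by rewrite formBC formB0r rmorph0 mul0r. Qed.

Definition formB_lin :=
  (formBDr, formBDl, formBNr, formBNl, formBZr, formBZl, formB0r, formB0l).

Lemma formB_sym0 u v : (B u v == 0) = (B v u == 0).
Proof. by rewrite (formBC v) mulf_eq0 (negPf lam_neq0) orbF bar_eq0. Qed.

Lemma formB_orthC u v : B u v = 0 -> B v u = 0.
Proof. by move/eqP; rewrite formB_sym0 => /eqP. Qed.

Lemma formB_base i v : B (sb i) v = chi i * v (opp i) 0.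
Proof.
rewrite formBE (bigD1 i) //= !mxE !eqxx rmorph1 mul1r big1 ?addr0 // => j.
by rewrite !mxE => /negPf ->; rewrite rmorph0 !mul0r.
Qed.

(** * The quadratic map *)

(** The sesquilinear form whose diagonal is the second component of [Q]. *)
Definition formh u v : K :=
  \sum_(i : 'I_(n.*2.+1) | (i < n)%N) (u i 0)^b * v (opp i) 0.

Lemma formBh u v :
  B u v = formh u v + (u 0i 0)^b * m * v 0i 0 + (formh v u)^b * l.
Proof.
congr (_ + _); rewrite rmorph_sum mulr_suml (reindex_inj (can_inj ind_oppK)) /=.
apply: eq_big => i; first by rewrite opp_gt.
by move=> _; rewrite ind_oppK rmorphM barK; ring.
Qed.

Lemma formhDD u v :
  formh (u + v) (u + v) = formh u u + formh v v + formh u v + formh v u.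
Proof.
by rewrite -!big_split /=; apply: eq_bigr => i _; rewrite !mxE rmorphD; ring.
Qed.

Lemma Delta1 : Delta H (0, 0).
Proof. by case: (Delta_Kmodule H) => -[]. Qed.

Lemma DeltaM p q : Delta H p -> Delta H q -> Delta H (p * q)%g.
Proof. by case: (Delta_Kmodule H) => -[_ DM _] _; exact: DM. Qed.

Lemma DeltaV p : Delta H p -> Delta H p^-1%g.
Proof. by case: (Delta_Kmodule H) => -[_ _ DV] _; exact: DV. Qed.

Lemma Delta_act p x : Delta H p -> Delta H (heis_act p x).
Proof. by case: (Delta_Kmodule H) => _; exact. Qed.

Lemma Delta_sub0 x : Delta H (0, x - x^b * l).
Proof. by apply: Delta_lower; exists x. Qed.

Lemma DeltaDr x y z : Delta H (x, y) -> Delta H (0, z) -> Delta H (x, y + z).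
Proof.
move=> Dp /(DeltaM Dp); congr (Delta H (_, _)); rewrite /= ?addr0 //.
by rewrite mulr0 subr0.
Qed.

Lemma DeltaDmin x y z : Delta H (x, y) -> Delta H (x, y + (z - z^b * l)).
Proof. by move/DeltaDr; apply; exact: Delta_sub0. Qed.

Lemma Delta_div p q : Delta H (p / q)%g -> Delta H q -> Delta H p.
Proof. by move=> Dpq /(DeltaM Dpq); rewrite mulgVK. Qed.

(** Polarisation of [Q]: the cross terms of [formh] and the twist of the
    Heisenberg product combine to [B u v] up to [Delta_min].  Through
    [formQ_div_Delta] this reduces membership in the unitary group to a
    condition on the displacement [v]. *)
Lemma formQ_div u v : exists x,
  (Q (u + v) / Q u)%g = (v 0i 0, formh v v + B u v + (x - x^b * l)).
Proof.
exists (formh v u + (v 0i 0)^b * m * u 0i 0).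
congr (_, _); rewrite /= !mxE; first ring.
rewrite -/(formh (u + v) (u + v)) -/(formh u u) formhDD formBh.
rewrite !(rmorphD, rmorphM) barK bar_mu /=.
field; exact: lam_neq0.
Qed.

Definition sing u := Delta H (Q u).

Lemma formQ_div_Delta u v :
  Delta H (v 0i 0, formh v v + B u v) -> Delta H (Q (u + v) / Q u)%g.
Proof. by have [x ->] := formQ_div u v; apply: DeltaDmin. Qed.

Lemma singD u v : sing u -> sing v -> B u v = 0 -> sing (u + v).
Proof.
move=> su sv Buv0; apply: (@Delta_div _ (Q u)) => //.
by apply: formQ_div_Delta; rewrite Buv0 addr0.
Qed.

Lemma formQZ x u : Q (x *: u) = heis_act (Q u) x.
Proof.
congr (_, _); rewrite /= ?mxE; first exact: mulrC.
rewrite mulr_sumr mulr_suml; apply: eq_bigr => i _; rewrite !mxE rmorphM; ring.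
Qed.

Lemma singZ x u : sing u -> sing (x *: u).
Proof. by rewrite /sing formQZ; apply: Delta_act. Qed.

Lemma singN u : sing u -> sing (- u).
Proof. by rewrite -scaleN1r; apply: singZ. Qed.

Lemma sing_formB u : sing u -> B u u = 0.
Proof.
move=> /(@Delta_upper _ H) /= <-; rewrite formBh /heis_tr /= -/(formh u u); ring.
Qed.

Lemma sing_base i : ind_hb i -> sing (sb i).
Proof.
move=> hbi; rewrite /sing /formQ mxE eq_sym (negPf hbi) /= big1; first exact: Delta1.
move=> j _; rewrite !mxE; have [->|] := eqVneq j i; last by rewrite rmorph0 mul0r.
by rewrite (negPf (opp_neq hbi)) mulr0.
Qed.

Lemma base_orth i j : opp i != j -> B (sb i) (sb j) = 0.
Proof. by rewrite formB_base mxE => /negPf ->; rewrite mulr0. Qed.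

Lemma base_opp i : B (sb i) (sb (opp i)) = chi i.
Proof. by rewrite formB_base mxE !eqxx mulr1. Qed.

(** * The radical *)

Definition rad u := forall w, B u w = 0.

(** Such a vector is [x e_0] with [bar x * mu * x = 0], so [x = 0], or [mu = 0]
    and [e_0] spans the radical. *)
Lemma sing_rad u : sing u -> (forall i, ind_hb i -> u i 0 = 0) -> rad u.
Proof.
move=> su u0 w; have /eqP := sing_formB su.
have BE v : B u v = (u 0i 0)^b * m * v 0i 0.
  rewrite formBE (bigD1 0i) //= big1 => [|i hbi]; last by rewrite u0 // rmorph0 !mul0r.
  by rewrite addr0 ind_opp0 /chi val_ind0 ltnn.
rewrite !BE !mulf_eq0 bar_eq0 orbAC orbb => /orP[] /eqP ->.
  by rewrite rmorph0 !mul0r.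
by rewrite mulr0 mul0r.
Qed.

Lemma rad_base i : ind_hb i -> ~ rad (sb i).
Proof.
by move=> /chi_neq0 /eqP chi_n0 /(_ (sb (opp i))); rewrite base_opp.
Qed.

Lemma rad_coord u i : ind_hb i -> rad u -> u i 0 = 0.
Proof.
move=> hbi /(_ (sb (opp i)))/formB_orthC/eqP.
by rewrite formB_base ind_oppK mulf_eq0 (negPf (chi_neq0 _)) ?ind_hb_opp // => /eqP.
Qed.

(** Independence modulo the radical, which is nonzero when [mu = 0]. *)
Definition indep u v := forall x y, rad (x *: u + y *: v) -> x = 0 /\ y = 0.

(** * Rank-one maps and Eichler transvections *)

Lemma mx_eq_act (A A' : mat) : (forall w, A *m w = A' *m w) -> A = A'.
Proof.
move=> eqA; apply/matrixP=> i j; have /colP/(_ i) := eqA (sb j).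
by rewrite -!colE !mxE.
Qed.

(** The map [w |-> u B(v, w)]. *)
Definition dyad u v : mat := u *m \row_j ((v (opp j) 0)^b * chi (opp j)).

Lemma dyadE u v w : dyad u v *m w = B v w *: u.
Proof.
rewrite /dyad -mulmxA [X in u *m X]mx11_scalar mul_mx_scalar; congr (_ *: _).
rewrite mxE formBE (reindex_inj (can_inj ind_oppK)) /=.
by apply: eq_bigr => i _; rewrite !mxE ind_oppK.
Qed.

(** For fixed [d] these are the unipotent maps that fix [d] and move its
    orthogonal space by multiples of [d]; [y] is the central coordinate.  Both
    kinds of transvections are of this form. *)
Definition eichler v d y : mat :=
  1%:M + dyad v d - l^-1 *: dyad d v + y *: dyad d d.

Lemma eichlerE v d y w :
  eichler v d y *m w = w + B d w *: v - (l^-1 * B v w) *: d + (y * B d w) *: d.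
Proof.
by rewrite /eichler !(mulmxDl, mulNmx) -!scalemxAl !dyadE mul1mx !scalerA.
Qed.

Lemma eichlerM v w d y z : B d d = 0 -> B v d = 0 -> B w d = 0 ->
  eichler v d y *m eichler w d z = eichler (v + w) d (y + z - l^-1 * B v w).
Proof.
move=> Bdd Bvd Bwd; apply: mx_eq_act => u; rewrite -mulmxA !eichlerE.
rewrite !formB_lin Bdd Bvd (formB_orthC Bwd).
by apply/colP=> i; rewrite !mxE; ring.
Qed.

Lemma eichler0 d : eichler 0 d 0 = 1%:M.
Proof.
apply: mx_eq_act => w; rewrite eichlerE formB0l mulr0 mul0r scaler0 !scale0r.
by rewrite subr0 !addr0 mul1mx.
Qed.

(** [v] counts modulo [d] up to a change of the central coordinate. *)
Lemma eichler_shift v d x :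
  eichler (v + x *: d) d 0 = eichler v d (x - l^-1 * x^b).
Proof.
apply: mx_eq_act => w; rewrite !eichlerE !formB_lin.
by apply/colP=> i; rewrite !mxE; ring.
Qed.

(** * The unitary group *)

Local Notation "g ** w" := (val g *m w) (at level 40).

Lemma actM g h w : (g * h)%g ** w = g ** (h ** w).
Proof. exact/esym/mulmxA. Qed.

Lemma act1 w : (1%g : GL) ** w = w.
Proof. exact: mul1mx. Qed.

Lemma actK g w : g^-1%g ** (g ** w) = w.
Proof. by rewrite -actM mulVg act1. Qed.

Lemma actVK g w : g ** (g^-1%g ** w) = w.
Proof. by rewrite -actM mulgV act1. Qed.

Lemma GL_eq_act g h : (forall w, g ** w = h ** w) -> g = h.
Proof. by move=> eq_gh; apply/val_inj/mx_eq_act. Qed.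

Lemma unitary_B g u v : U g -> B (g ** u) (g ** v) = B u v.
Proof. by case. Qed.

Lemma unitary1 : U 1%g.
Proof.
by split=> [u v|u]; rewrite !act1 // mulgV; apply: Delta1.
Qed.

Lemma unitaryM g h : U g -> U h -> U (g * h)%g.
Proof.
move=> [gB gQ] [hB hQ]; split=> [u v|u]; rewrite !actM; first by rewrite gB hB.
by have := DeltaM (gQ (h ** u)) (hQ u); rewrite mulgA mulgVK.
Qed.

Lemma unitaryV g : U g -> U g^-1%g.
Proof.
move=> [gB gQ]; split=> [u v|u]; first by rewrite -gB !actVK.
by have := DeltaV (gQ (g^-1%g ** u)); rewrite actVK invgF.
Qed.

Lemma unitary_sing g u : U g -> sing u -> sing (g ** u).
Proof. by move=> [_ gQ]; apply: Delta_div (gQ u). Qed.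

Lemma unitary_rad g u : U g -> rad (g ** u) -> rad u.
Proof. by move=> Ug ru w; rewrite -(unitary_B _ _ Ug) ru. Qed.

Lemma GL_of_mx (A A' : mat) : A *m A' = 1%:M -> exists g : GL, val g = A.
Proof. by move=> /mulmx1_unit[uA _]; exists (UnitGroup uA). Qed.

Definition sing_pair v d := [/\ sing v, sing d & B v d = 0].

(** The identity serves as default value when the matrix is not invertible,
    which does not happen for orthogonal singular vectors. *)
Definition trans v d : GL := insubd (1%g : GL) (eichler v d 0).

Lemma val_trans v d : sing_pair v d -> val (trans v d) = eichler v d 0.
Proof.
move=> [sv sd Bvd]; apply: insubdK.
suff /GL_of_mx[g <-] : eichler v d 0 *m eichler (- v) d 0 = 1%:M by apply: valP.
rewrite eichlerM ?formBNl ?Bvd ?oppr0 ?sing_formB // formBNr sing_formB //.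
by rewrite subrr !(oppr0, mulr0, subr0, addr0) eichler0.
Qed.

Lemma transE v d w : sing_pair v d ->
  trans v d ** w = w + B d w *: v - (l^-1 * B v w) *: d.
Proof. by move/val_trans ->; rewrite eichlerE mul0r scale0r addr0. Qed.

(** The displacement of [w] is a combination of [v] and [d], hence singular, and
    its product with [w] has the form [x - bar x * lambda]. *)
Lemma unitary_trans v d : sing_pair v d -> U (trans v d).
Proof.
move=> vd; have [sv sd Bvd] := vd; have Bdv := formB_orthC Bvd.
split=> [u w|w].
  rewrite !transE // !formB_lin !sing_formB // Bvd Bdv.
  rewrite (formBC v u) (formBC d u) !rmorphM fmorphV bar_lam.
  by field; rewrite lam_neq0 oner_eq0.
rewrite transE // -addrA; apply: formQ_div_Delta.
set z := B d w *: v - (l^-1 * B v w) *: d.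
have sz : sing z.
  by apply: singD; [apply: singZ | apply/singN/singZ | rewrite !formB_lin Bvd; ring].
apply: DeltaDr => //; rewrite !formB_lin (formBC v w) (formBC d w).
have := Delta_sub0 (B d w * ((B v w)^b * l)); congr (Delta H (_, _)).
by rewrite !rmorphM barK bar_lam; field; exact: lam_neq0.
Qed.

Lemma sing_pair_unitary g v d : U g -> sing_pair v d -> sing_pair (g ** v) (g ** d).
Proof.
by move=> Ug [sv sd Bvd]; split; rewrite ?unitary_B //; apply: unitary_sing.
Qed.

Lemma trans_conj g v d : U g -> sing_pair v d ->
  (g * trans v d * g^-1)%g = trans (g ** v) (g ** d).
Proof.
move=> Ug vd; apply: GL_eq_act => w; rewrite !actM transE //.
rewrite transE; last exact: sing_pair_unitary.
rewrite -[w in RHS](actVK g) !unitary_B //.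
by rewrite !(mulmxDr, mulmxN, scalemxAr).
Qed.

Lemma indep_unitary g u v : U g -> indep u v -> indep (g ** u) (g ** v).
Proof.
by move=> Ug uv x y; rewrite !scalemxAr -mulmxDr => /(unitary_rad Ug)/uv.
Qed.

(** * Transitivity *)

(** The quasi-reflection [w |-> w + z B(v, u)^-1 B(z, w)] with [z = v - u].  It
    is unitary because [Q(z)] times [(0, B(u, v))] is in [Delta], by
    polarisation of [Q] at [v - u]. *)
Lemma reflection u v : sing u -> sing v -> B u v != 0 ->
  exists g, [/\ U g, g ** u = v &
    forall t, B u t = 0 -> B v t = 0 -> g ** t = t].
Proof.
move=> su sv Buv; have Bvu : B v u != 0 by rewrite formB_sym0.
pose z := v - u; pose R x : mat := 1%:M + x *: dyad z z.
have RE x w : R x *m w = w + (x * B z w) *: z.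
  by rewrite mulmxDl mul1mx -scalemxAl dyadE scalerA.
have Bzz : B z z = - B u v - B v u.
  by rewrite !formB_lin !sing_formB //; ring.
have Bvu_barV : (B v u)^-1^b = l / B u v.
  rewrite fmorphV (formBC u v) rmorphM barK bar_lam.
  by field; rewrite Buv lam_neq0.
have Dz : Delta H (z 0i 0, formh z z + B u v).
  (* B(u, v) - B(v, u) has the form x - bar x * lambda *)
  have [x zE] := formQ_div v (- u).
  apply: (@Delta_div _ (Q v)) => //.
  have -> : (((z 0i 0, formh z z + B u v) : heis H) / Q v)%g
      = ((Q z / Q v)%g.1, (Q z / Q v)%g.2 + B u v) :> heis H.
    by congr (_, _); rewrite /= -/(formh z z); ring.
  rewrite zE /= formBNr (formBC u v).
  have := DeltaDmin (B u v) (DeltaDmin x (singN su)).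
  by congr (Delta H (_, _)); rewrite /= -/(formh (- u) (- u)); ring.
have [|g gE] := @GL_of_mx (R (B v u)^-1) (R (B u v)^-1).
  apply: mx_eq_act => w; rewrite -mulmxA !RE mul1mx.
  rewrite formBDr formBZr Bzz; apply/colP=> i; rewrite !mxE.
  by field; rewrite Buv Bvu.
exists g; split.
- split=> [w w'|w]; rewrite gE !RE.
    rewrite formBDl !formBDr !formBZl !formBZr Bzz (formBC z w).
    rewrite rmorphM Bvu_barV; field.
    by rewrite Buv Bvu.
  apply: formQ_div_Delta; rewrite -[formh _ _]/((Q _).2) formQZ.
  have := Delta_act ((B v u)^-1 * B z w) Dz; congr (Delta H (_, _)).
    by rewrite [RHS]mxE mulrC.
  rewrite formBZr (formBC z w) /= -/(formh z z) rmorphM Bvu_barV.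
  by field; rewrite Buv Bvu.
- rewrite gE RE !formB_lin sing_formB // oppr0 addr0 mulVf // scale1r.
  by rewrite addrC subrK.
- move=> t But Bvt; rewrite gE RE !formB_lin But Bvt subrr mulr0 scale0r.
  exact: addr0.
Qed.

Lemma reflection2 u v w : sing u -> sing v -> sing w ->
    B u w != 0 -> B w v != 0 ->
  exists g, [/\ U g, g ** u = v &
    forall t, B u t = 0 -> B w t = 0 -> B v t = 0 -> g ** t = t].
Proof.
move=> su sv sw /(reflection su sw)[g [Ug gu gt]].
move=> /(reflection sw sv)[h [Uh hw ht]].
exists (h * g)%g; split; first exact: unitaryM.
  by rewrite actM gu hw.
by move=> t Bu Bw Bv; rewrite actM gt // ht.
Qed.

(** If the coordinates of [a] at [k] and [-k] vanish, then [e_-j + e_-k] is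
    orthogonal neither to [a] nor to [e_k] and serves as the intermediate
    vector.  The list of vectors to which a fixed [t] has to be orthogonal
    allows the move to be repeated in the stabiliser of a basis vector. *)
Lemma move_to_base a j k : sing a -> ind_hb j -> ind_hb k -> a j 0 != 0 ->
  exists g, [/\ U g, g ** a = sb k &
    forall t, B a t = 0 -> B (sb k) t = 0 -> B (sb (opp k)) t = 0 ->
      B (sb (opp j)) t = 0 -> g ** t = t].
Proof.
move=> sa hbj hbk aj; have sk := sing_base hbk.
have sok : sing (sb (opp k)) by apply: sing_base; rewrite ind_hb_opp.
have soj : sing (sb (opp j)) by apply: sing_base; rewrite ind_hb_opp.
have Bbase i : ind_hb i -> (B a (sb (opp i)) == 0) = (a i 0 == 0).
  move=> hbi; rewrite formB_sym0 formB_base ind_oppK mulf_eq0.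
  by rewrite (negPf (chi_neq0 _)) ?ind_hb_opp.
have Bopp i : ind_hb i -> B (sb (opp i)) (sb i) != 0.
  by move=> hbi; rewrite formB_sym0 base_opp chi_neq0.
have [aok|aok] := eqVneq (a (opp k) 0) 0; last first.
  have [|g [Ug ga gt]] := reflection sa sk.
    by rewrite -[k]ind_oppK Bbase ?ind_hb_opp.
  by exists g; split=> // t *; apply: gt.
have [ak|ak] := eqVneq (a k 0) 0; last first.
  have [||g [Ug ga gt]] := reflection2 sa sk sok; rewrite ?Bbase ?Bopp //.
  by exists g; split=> // t *; apply: gt.
have jk : j != k by apply: contra_neq aj => ->.
have sw : sing (sb (opp j) + sb (opp k)).
  apply: singD => //; apply: base_orth; rewrite ind_oppK.
  by apply: contra_neq aj => ->.
have [||g [Ug ga gt]] := reflection2 sa sk sw.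
- rewrite formBDr [X in _ + X](_ : _ = 0) ?addr0 ?Bbase //.
  by apply/eqP; rewrite Bbase ?ak.
- by rewrite formBDl base_orth ?ind_oppK // add0r Bopp.
exists g; split=> // t Bat Bkt Bokt Bojt; apply: gt => //.
by rewrite formBDl Bojt Bokt addr0.
Qed.

Lemma radZ x u : rad u -> rad (x *: u).
Proof. by move=> ru w; rewrite formBZl ru mulr0. Qed.

Lemma radD u v : rad u -> rad v -> rad (u + v).
Proof. by move=> ru rv w; rewrite formBDl ru rv addr0. Qed.

Lemma sing_coord u : sing u -> ~ rad u -> exists2 i, ind_hb i & u i 0 != 0.
Proof.
move=> su nru; apply: contrapT => no_i; apply/nru/sing_rad => // i hbi.
by apply/eqP; apply: contrapT => ui; apply: no_i; exists i => //; apply/negP.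
Qed.

(** Transitivity on independent pairs: [d] is moved to [e_p] first, and then the
    image of [v] to [e_q] inside the stabiliser of [e_p]. *)
Lemma sing_pair_to_base v d p q : sing_pair v d -> indep v d ->
    ind_hb p -> ind_hb q -> q != p -> q != opp p ->
  exists g, [/\ U g, g ** v = sb q & g ** d = sb p].
Proof.
move=> vd ivd hbp hbq qp qop; have [sv sd Bvd] := vd.
have [|j hbj dj] := sing_coord sd.
  move=> rd; have /ivd[_ /eqP] : rad (0 *: v + 1 *: d) by rewrite scale0r add0r scale1r.
  by rewrite oner_eq0.
have [g [Ug gd _]] := move_to_base sd hbj hbp dj.
have := sing_pair_unitary Ug vd; have := indep_unitary Ug ivd; rewrite gd.
set v1 := g ** v => iv1 [sv1 sp Bv1p]; pose v2 := v1 - v1 p 0 *: sb p.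
have [||k hbk v2k] := @sing_coord v2.
- apply: singD; rewrite -?scaleNr ?formBZr ?Bv1p ?mulr0 //.
  by apply: singZ; apply: sing_base.
- move=> rv2; have /iv1[/eqP] : rad (1 *: v1 + (- v1 p 0) *: sb p).
    by rewrite scale1r scaleNr.
  by rewrite oner_eq0.
have kp : k != p by apply: contra_neq v2k => ->; rewrite !mxE !eqxx mulr1 subrr.
have v1k : v1 k 0 != 0.
  by move: v2k; rewrite !mxE (negPf kp) mulr0 subr0.
have [h [Uh hv1 ht]] := move_to_base sv1 hbk hbq v1k.
exists (h * g)%g; split; rewrite ?actM //; first exact: unitaryM.
rewrite gd ht // base_orth ?ind_oppK //.
by rewrite opp_eq.
Qed.

(** * Commutators of transvections *)

Lemma transV v d : sing_pair v d -> (trans v d)^-1%g = trans (- v) d.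
Proof.
move=> vd; have [sv sd Bvd] := vd.
have Nvd : sing_pair (- v) d by split; rewrite ?formBNl ?Bvd ?oppr0 //; apply: singN.
apply: mulg1_eq; apply: val_inj.
rewrite [LHS]/= !val_trans //.
rewrite [LHS]eichlerM ?formBNl ?formBNr ?Bvd ?sing_formB ?oppr0 //.
by rewrite subrr !(mulr0, subr0, addr0) eichler0.
Qed.

Lemma indep_shift a d x : indep a d -> indep (a + x *: d) d.
Proof.
move=> iad y z; rewrite scalerDr scalerA -addrA -scalerDl => /iad[-> ].
by rewrite mul0r add0r.
Qed.

(** [trans p q] fixes [d] and translates [c] by [a], so the left-hand side is
    [trans (c + a) d * trans (- c) d].  Its central coordinate
    [lambda^-1 B(a, c)] has the form [s - lambda^-1 bar s], and is absorbed
    into the multiple [s d] of [d]. *)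
Lemma trans_commutator p q c d :
    sing_pair p q -> sing_pair c d -> B p d = 0 -> B q d = 0 ->
    let a := B q c *: p - (l^-1 * B p c) *: q in
    let s := - ((B p c)^b * B q c) in
  (trans p q * trans c d * (trans p q)^-1 * (trans c d)^-1)%g
  = trans (a + s *: d) d /\ sing_pair (a + s *: d) d.
Proof.
move=> pq cd Bpd Bqd a s; have [sp sq Bpq] := pq; have [sc sd Bcd] := cd.
have Upq := unitary_trans pq; have gd : trans p q ** d = d.
  by rewrite transE // Bpd Bqd mulr0 !scale0r subr0 addr0.
have gc : trans p q ** c = c + a by rewrite transE // addrA.
have Bad : B a d = 0 by rewrite !formB_lin Bpd Bqd !mulr0 subr0.
have sa : sing a.
  apply: singD; [exact: singZ | exact/singN/singZ |].
  by rewrite !formB_lin Bpq !(mulr0, oppr0).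
have asd : sing_pair (a + s *: d) d.
  split=> //; first by apply: singD => //; [exact: singZ | rewrite formBZr Bad mulr0].
  by rewrite formBDl formBZl Bad sing_formB // mulr0 addr0.
split=> //; rewrite trans_conj // gd gc transV //; apply: val_inj.
rewrite [LHS]/= !val_trans //; last 2 first.
- by split; rewrite ?formBNl ?Bcd ?oppr0 //; apply: singN.
- by rewrite -gc -gd; apply: sing_pair_unitary.
have Bcad : B (c + a) d = 0 by rewrite formBDl Bcd Bad addr0.
rewrite [LHS]eichlerM ?sing_formB // ?formBNl ?Bcd ?oppr0 //.
rewrite [c + a]addrC addrK eichler_shift; congr eichler.
rewrite !formB_lin (sing_formB sc) !(rmorphN, rmorphM) fmorphV barK bar_lam invrK.
by rewrite /s; field; exact: lam_neq0.
Qed.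

(** * Totally singular spaces in general position *)

(** Let [a] be the first vector of the independent pair, [F] the totally
    isotropic span of [c], [f], [g], and [D] the space of the vectors of [F] orthogonal to [p] and [q], which has dimension at least
    one.  If [p] and [q] induce proportional functionals on [F], then [D] has
    dimension two and cannot lie in a single line modulo the radical.
    Otherwise, if [a] were proportional to a vector of [D], then [a] would be
    orthogonal to [F], and a nontrivial combination of the two functionals would
    vanish. *)
Lemma exists_orth_indep (p q c f g : vect) :
    indep p q -> B p c != 0 \/ B q c != 0 ->
    (forall x y z, rad (x *: c + y *: f + z *: g) -> [/\ x = 0, y = 0 & z = 0]) ->
    B c c = 0 -> B f c = 0 -> B g c = 0 -> B c f = 0 -> B f f = 0 -> B g f = 0 ->
    B c g = 0 -> B f g = 0 -> B g g = 0 ->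
  exists x y z, let d := x *: c + y *: f + z *: g in
    [/\ B p d = 0, B q d = 0 & indep (B q c *: p - (l^-1 * B p c) *: q) d].
Proof.
move=> ipq Bpqc icfg Bcc Bfc Bgc Bcf Bff Bgf Bcg Bfg Bgg; set a := _ - _.
have nra : ~ rad a.
  rewrite /a -scaleNr => /ipq[/eqP Bqc0 /eqP].
  rewrite oppr_eq0 mulf_eq0 invr_eq0 (negPf lam_neq0) => /eqP Bpc0.
  by case: Bpqc; rewrite ?Bpc0 ?(eqP Bqc0) eqxx.
have depP d : (forall y, rad (y *: d) -> y = 0) -> ~ indep a d ->
    exists y, rad (a + y *: d).
  move=> nrd nad; apply: contrapT => no_y; apply: nad => x y rxy.
  have [x0|x0] := eqVneq x 0.
    by move: rxy; rewrite x0 scale0r add0r => /nrd.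
  case: no_y; exists (x^-1 * y); have := radZ x^-1 rxy.
  by rewrite scalerDr !scalerA mulVf // scale1r.
(* D t = 0 means that some multiple of c can be subtracted from t so that the
   result is orthogonal to p and q. *)
pose D t := B p t * B q c - B q t * B p c.
have DP t : D t = 0 -> exists r : K, B p (t - r *: c) = 0 /\ B q (t - r *: c) = 0.
  move=> Dt; case: Bpqc => Bc0.
    exists (B p t / B p c); rewrite !formB_lin; split; first by rewrite divfK // subrr.
    have -> : B q t - B p t / B p c * B q c = - D t / B p c by rewrite /D; field.
    by rewrite Dt oppr0 mul0r.
  exists (B q t / B q c); rewrite !formB_lin; split; last by rewrite divfK // subrr.
  have -> : B p t - B q t / B q c * B p c = D t / B q c by rewrite /D; field.
  by rewrite Dt mul0r.
have [Dfg|Dfg] := pselect (D f = 0 /\ D g = 0).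
  have [[k1 [Bp1 Bq1]] [k2 [Bp2 Bq2]]] := (DP f Dfg.1, DP g Dfg.2).
  pose d1 := f - k1 *: c; pose d2 := g - k2 *: c.
  have [i1|ni1] := pselect (indep a d1).
    exists (- k1), 1, 0 => d; suff -> : d = d1 by [].
    by rewrite /d scale1r scale0r addr0 scaleNr addrC.
  have [i2|ni2] := pselect (indep a d2).
    exists (- k2), 0, 1 => d; suff -> : d = d2 by [].
    by rewrite /d scale1r scale0r addr0 scaleNr addrC.
  have indep12 y z : rad (y *: d1 + z *: d2) -> y = 0 /\ z = 0.
    have -> : y *: d1 + z *: d2 = (- (y * k1) - z * k2) *: c + y *: f + z *: g.
      by apply/colP=> i; rewrite !mxE; ring.
    by move=> /icfg[_ -> ->].
  have [|y1 r1] := depP d1 _ ni1.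
    by move=> y ry; have [|-> //] := indep12 y 0; rewrite scale0r addr0.
  have [|y2 r2] := depP d2 _ ni2.
    by move=> y ry; have [|_ -> //] := indep12 0 y; rewrite scale0r add0r.
  have [|y10 _] := indep12 y1 (- y2).
    have := radD r1 (radZ (-1) r2); congr (rad _).
    by apply/colP=> i; rewrite !mxE; ring.
  by case: nra; move: r1; rewrite y10 scale0r addr0.
have [|k [Bp Bq]] := DP (D g *: f - D f *: g).
  by rewrite /D !formB_lin; ring.
exists (- k), (D g), (- D f) => d.
have dE : d = D g *: f - D f *: g - k *: c.
  by rewrite /d; apply/colP=> i; rewrite !mxE; ring.
rewrite dE; split=> //; rewrite -dE; apply: contrapT => /depP[y|y rady].
  rewrite /d !(scalerDr, scalerA) => /icfg[_ /eqP yDg /eqP].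
  rewrite mulrN oppr_eq0 => yDf; have [//|y0] := eqVneq y 0; case: Dfg.
  move: yDg yDf; rewrite !mulf_eq0 (negPf y0) /= => /eqP Dg0 /eqP Df0.
  by split.
(* The vector a, now proportional to d, is orthogonal to the whole of F. *)
have Ba t : B c t = 0 -> B f t = 0 -> B g t = 0 -> B a t = 0.
  move=> Bct Bft Bgt; have := rady t.
  by rewrite formBDl formBZl !formB_lin Bct Bft Bgt !(mulr0, addr0).
have BaE t : B a t = (B q c)^b * B p t - l * (B p c)^b * B q t.
  by rewrite !formB_lin rmorphM fmorphV bar_lam invrK; ring.
have D0 t : B a t = 0 -> D t = 0.
  have := Ba c Bcc Bfc Bgc; rewrite !BaE => /subr0_eq E1 /subr0_eq E2.
  have [Bc0|Bc0] := Bpqc.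
    have /mulfI : l * (B p c)^b != 0 by rewrite mulf_neq0 ?lam_neq0 ?bar_eq0.
    apply; rewrite mulr0.
    transitivity (B p t * (l * (B p c)^b * B q c) - l * (B p c)^b * B q t * B p c).
      by rewrite /D; ring.
    by rewrite -E1 -E2; ring.
  have /mulfI : (B q c)^b != 0 by rewrite bar_eq0.
  apply; rewrite mulr0.
  transitivity ((B q c)^b * B p t * B q c - B q t * ((B q c)^b * B p c)).
    by rewrite /D; ring.
  by rewrite E1 E2; ring.
by apply: Dfg; split; apply/D0/Ba.
Qed.

(** * Products of four conjugates *)

(** This is where [3 <= n] matters: each of [i] and [j] excludes only one of the
    three smallest indices. *)
Lemma ind_avoid i j : (3 <= n)%N ->
  exists k, [/\ (k < n)%N, k != i, k != opp i, k != j & k != opp j].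
Proof.
move=> hn; pose ok (k0 : nat) :=
  [&& k0 != i :> nat, k0 != opp i :> nat, k0 != j :> nat & k0 != opp j :> nat].
have : [|| ok 0%N, ok 1%N | ok 2%N].
  by rewrite /ok !val_opp; have := ltn_ord i; have := ltn_ord j; lia.
have use (k0 : nat) : (k0 < 3)%N -> ok k0 ->
    exists k, [/\ (k < n)%N, k != i, k != opp i, k != j & k != opp j].
  move=> lt_k03 /and4P[*]; have lt_k0 : (k0 < n.*2.+1)%N by lia.
  by exists (Ordinal lt_k0); split=> //; apply: leq_trans hn.
by case/or3P; apply: use.
Qed.

Lemma ind_hb_lt k : (k < n)%N -> ind_hb k.
Proof. by rewrite ind_hbE => ->. Qed.

Lemma base_indep i j : ind_hb i -> ind_hb j -> i != j -> indep (sb i) (sb j).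
Proof.
move=> hi hj ij x y r; have := rad_coord hi r; have := rad_coord hj r.
rewrite !mxE !eqxx (negPf ij) eq_sym (negPf ij) !(mulr0, mulr1, addr0, add0r).
by split.
Qed.

Lemma base_indep3 i j k x y z : ind_hb i -> ind_hb j -> ind_hb k ->
    i != j -> i != k -> j != k ->
  rad (x *: sb i + y *: sb j + z *: sb k) -> [/\ x = 0, y = 0 & z = 0].
Proof.
move=> hi hj hk /negPf ij /negPf ik /negPf jk r.
have ji := ij; have ki := ik; have kj := jk; rewrite eq_sym in ji.
rewrite eq_sym in ki; rewrite eq_sym in kj.
have := rad_coord hi r; have := rad_coord hj r; have := rad_coord hk r.
rewrite !mxE !eqxx ij ik jk ji ki kj !(mulr0, mulr1, addr0, add0r) /=.
by split.
Qed.

Lemma rad_unitary g u : U g -> rad u -> rad (g ** u).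
Proof. by move=> Ug ru w; rewrite -[w](actVK g) unitary_B. Qed.

Lemma trans_conjugate v d v' d' : (3 <= n)%N ->
    sing_pair v d -> indep v d -> sing_pair v' d' -> indep v' d' ->
  exists t, U t /\ trans v d = (trans v' d' ^ t)%g.
Proof.
move=> hn vd ivd vd' ivd'.
have [p [/ind_hb_lt hp _ _ _ _]] := ind_avoid 0i 0i hn.
have [q [/ind_hb_lt hq qp qop _ _]] := ind_avoid p p hn.
have [g [Ug gv gd]] := sing_pair_to_base vd ivd hp hq qp qop.
have [h [Uh hv hd]] := sing_pair_to_base vd' ivd' hp hq qp qop.
exists (h^-1 * g)%g; split; first by apply: unitaryM => //; apply: unitaryV.
have Ut : U (h^-1 * g)^-1%g by apply/unitaryV/unitaryM => //; apply: unitaryV.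
rewrite conjgE mulgA -[X in (_ * _ * X)%g]invgK trans_conj //.
by rewrite invgM invgK !actM hv hd -gv -gd !actK.
Qed.

(** The plane is spanned by [e_j] and [e_k], and the totally singular space by
    [e_i], [e_f], [e_k], with [f] chosen so that [e_j] is one of the three. *)
Lemma trans_power4 (X : set GL) (r : GL) i j : (3 <= n)%N ->
    (forall h, X h -> X h^-1%g) -> (forall h g, U g -> X h -> X (h ^ g)%g) ->
    U r -> X r -> ind_hb i -> ind_hb j -> i != opp j ->
    B (r ** sb j) (sb i) != 0 ->
  forall v d, sing_pair v d -> indep v d -> set_power X 4 (trans v d).
Proof.
move=> hn XV XJ Ur Xr hi hj ij Bij.
have [k [/ind_hb_lt hk ki koi kj koj]] := ind_avoid i j hn.
have [k' [/ind_hb_lt hk' ki' koi' kk' kok']] := ind_avoid i k hn.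
pose f := if i == j then k' else j.
have [hf fi foi fk fok] : [/\ ind_hb f, f != i, f != opp i, f != k & f != opp k].
  rewrite /f; case: eqVneq => [_|ni]; first by split.
  by split; rewrite // eq_sym ?opp_eq.
have jif : j = i \/ j = f by rewrite /f; case: eqVneq; [left | right].
have orthb i1 j1 : ind_hb i1 -> i1 = j1 \/ i1 != opp j1 -> B (sb i1) (sb j1) = 0.
  by move=> hi1 ij1; apply: base_orth; rewrite opp_eq;
    case: ij1 => [<-|//]; rewrite eq_sym opp_neq.
have Bii := orthb i i hi (or_introl erefl).
have Bff := orthb f f hf (or_introl erefl).
have Bkk := orthb k k hk (or_introl erefl).
have Bfi := orthb f i hf (or_intror foi).
have Bki := orthb k i hk (or_intror koi).
have Bfk := orthb f k hf (or_intror fok).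
have Bif := formB_orthC Bfi; have Bik := formB_orthC Bki.
have Bkf := formB_orthC Bfk.
have [Bji Bjf Bjk] : [/\ B (sb j) (sb i) = 0, B (sb j) (sb f) = 0 &
    B (sb j) (sb k) = 0] by case: jif => ->.
have jk : sing_pair (sb j) (sb k) by split=> //; apply: sing_base.
have ijk : indep (sb j) (sb k).
  by apply: base_indep => //; case: jif => ->; rewrite // eq_sym.
have [|x [y [z]]] := @exists_orth_indep (r ** sb j) (r ** sb k) (sb i) (sb f) (sb k)
  (indep_unitary Ur ijk) (or_introl Bij) _ Bii Bfi Bki Bif Bff Bkf Bik Bfk Bkk.
  move=> x y z; apply: base_indep3; rewrite // eq_sym //.
set d := _ + z *: _ => -[Bpd Bqd iad].
have Fd v : B v (sb i) = 0 -> B v (sb f) = 0 -> B v (sb k) = 0 -> B v d = 0.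
  by move=> Bvi Bvf Bvk; rewrite !formB_lin Bvi Bvf Bvk !mulr0 !addr0.
have cd : sing_pair (sb i) d.
  split; [exact: sing_base | | exact: Fd].
  have sZ t i1 : ind_hb i1 -> sing (t *: sb i1).
    by move=> hi1; apply/singZ/sing_base.
  apply: singD; last by rewrite !formB_lin Bik Bfk !(mulr0, addr0).
    by apply: singD; rewrite ?formB_lin ?Bif ?mulr0 ?mulr0; auto.
  exact: sZ.
have fixF v : B (sb j) v = 0 -> B (sb k) v = 0 -> trans (sb j) (sb k) ** v = v.
  by move=> Bj Bk; rewrite transE // Bj Bk mulr0 !scale0r subr0 addr0.
have comm : commute (trans (sb j) (sb k)) (trans (sb i) d).
  apply: (mulIg (trans (sb j) (sb k))^-1%g); rewrite mulgK trans_conj //.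
    by rewrite !fixF //; apply: Fd.
  exact: unitary_trans.
have := double_commutator_power4 (X := X) XV _ _ comm Xr.
rewrite (trans_conj Ur jk) => {}power4.
have [E fl] := trans_commutator (sing_pair_unitary Ur jk) cd Bpd Bqd.
move: power4; rewrite E => power4 v w vw ivw.
have [t [Ut ->]] := trans_conjugate hn vw ivw fl (indep_shift iad).
apply: set_power_conj => [x0|]; first exact: XJ.
apply: power4 => x0; apply: XJ; apply: unitaryV; exact: unitary_trans.
Qed.

(** * Elementary transvections *)

Lemma delta_act i j w : delta_mx i j *m w = w j 0 *: sb i.
Proof.
apply/colP=> k; rewrite !mxE (bigD1 j) //= big1 => [|k' /negPf k'j].
  by rewrite addr0 !mxE eqxx !andbT mulrC.
by rewrite mxE k'j andbF mul0r.
Qed.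

Lemma eps_lt i : (i < n)%N -> eps i = 1.
Proof. by rewrite /eps => ->. Qed.

Lemma eps_gt i : (n < i)%N -> eps i = -1.
Proof. by rewrite /eps => lt_ni; rewrite ltnNge ltnW. Qed.

(** One nontrivial short root transvection is enough to see that the elementary
    subgroup does not fix all the lines of basis vectors. *)
Lemma short_root1 i j : (i < n)%N -> (j < n)%N ->
  short_root H i j 1 = eichler (sb i) (l *: sb (opp j)) 0.
Proof.
move=> lt_in lt_jn; apply: mx_eq_act => w.
rewrite eichlerE /short_root !eps_lt // !(mulmxDl, mulNmx) -!scalemxAl !delta_act.
rewrite mul1mx rmorph1 !formB_lin !formB_base ind_oppK bar_lam.
rewrite /chi lt_in opp_lt opp_gt lt_jn ltnNge ltnW //=.
apply/colP=> k; rewrite !mxE (_ : l ^ _ = 1) //.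
by field; exact: lam_neq0.
Qed.

(** The factor [t] absorbs the powers of [lambda] that distinguish positive from
    negative indices. For negative [i] the condition on [z] amounts to
    inverting [(x, y)] in the Heisenberg group and acting by -1. *)
Lemma extra_short_root_eichler i x y : ind_hb i ->
    heis_signed (Delta H) (- eps i) (x, y) ->
  exists t z, [/\ t != 0, Delta H (x, z^b) &
    extra_short_root H i x y = eichler (x *: sb 0i) (t *: sb i) z].
Proof.
rewrite ind_hbE => /orP[lt_in|lt_ni].
  rewrite eps_lt // => Dxy; exists 1, y; split; rewrite ?oner_eq0 //.
  apply: mx_eq_act => w; rewrite eichlerE /extra_short_root eps_lt //.
  rewrite !(mulmxDl, mulNmx) -!scalemxAl !delta_act mul1mx scale1r.
  rewrite !formB_lin !formB_base /chi val_ind0 !ltnn lt_in ind_opp0 mul1r.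
  apply/colP=> k; rewrite !mxE (_ : l ^ _ = l^-1) //; ring.
rewrite eps_gt // => Dxy; exists l, (l^-1 * y); split; first exact: lam_neq0.
  have := DeltaV (Delta_act (-1) Dxy); congr (Delta H (_, _)) => /=.
    by rewrite mulrN1 opprK.
  have := Delta_upper Dxy; rewrite /Delta_max /= /heis_tr /= => tr0.
  rewrite !(rmorphM, rmorphN, rmorph1) fmorphV bar_lam invrK.
  apply/eqP; rewrite -subr_eq0 -[X in _ == X]oppr0 -tr0; apply/eqP; ring.
apply: mx_eq_act => w; rewrite eichlerE /extra_short_root eps_gt //.
rewrite !(mulmxDl, mulNmx) -!scalemxAl !delta_act mul1mx.
rewrite !formB_lin !formB_base /chi val_ind0 !ltnn lt_ni ind_opp0.
rewrite ltnNge (ltnW lt_ni) /= bar_lam.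
apply/colP=> k; rewrite !mxE (_ : l ^ _ = 1) //.
by field; exact: lam_neq0.
Qed.

(** The vector [s] is singular with [Q s = (x, bar z)], and adding up [s],
    [- e_k] and [- bar z e_-k] in the Heisenberg-like group of [eichlerM]
    produces exactly the central coordinate [z]. *)
Lemma extra_power12 (X : set GL) g0 :
    (3 <= n)%N -> X g0 -> X g0^-1%g ->
    (forall v d, sing_pair v d -> indep v d -> set_power X 4 (trans v d)) ->
  extra_short_transvections (Delta H) `<=` set_power X 12.
Proof.
move=> hn Xg0 XVg0 power4 g [i [x [y [hi Dxy gE]]]].
have [t [z [t0 Dxz rootE]]] := extra_short_root_eichler hi Dxy.
have [k [lt_kn ki koi _ _]] := ind_avoid i i hn; have hk := ind_hb_lt lt_kn.
have hok : ind_hb (opp k) by rewrite ind_hb_opp.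
pose d := t *: sb i; pose s := x *: sb 0i + sb k + z^b *: sb (opp k).
have k0 : k != 0i := hk; have ok0 : opp k != 0i := hok; have i0 : i != 0i := hi.
have kok : opp k != k := opp_neq hk.
have iok : i == opp k = false by rewrite -opp_eq eq_sym; apply: negPf.
have ik : i == k = false by rewrite eq_sym; apply: negPf.
have sE j : s j 0 = (j == 0i)%:R * x + (j == k)%:R + (j == opp k)%:R * z^b.
  by rewrite !mxE !andbT; ring.
have s0 : s 0i 0 = x.
  by rewrite sE eqxx eq_sym (negPf k0) eq_sym (negPf ok0) mul1r mul0r !addr0.
have sk : s k 0 = 1.
  by rewrite sE eqxx (negPf k0) [k == _]eq_sym (negPf kok) !mul0r add0r addr0.
have sok : s (opp k) 0 = z^b.
  by rewrite sE eqxx (negPf ok0) (negPf kok) mul0r !add0r mul1r.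
have soi : s (opp i) 0 = 0.
  rewrite sE -[opp i == 0i]negbK -/(ind_hb _) ind_hb_opp hi !opp_eq ind_oppK iok ik.
  by rewrite !mul0r !addr0.
have ss : sing s.
  rewrite /sing (_ : Q s = (x, z^b)) //; congr (_, _); first exact: s0.
  rewrite (bigD1 k) //= sk sok rmorph1 mul1r big1 ?addr0 // => j /andP[lt_jn jk].
  have j0 : j != 0i := ind_hb_lt lt_jn.
  have jok : j == opp k = false.
    by apply: contraTF lt_jn => /eqP ->; rewrite opp_lt ltnNge ltnW.
  by rewrite sE (negPf j0) jok (negPf jk) !mul0r !addr0 rmorph0 mul0r.
have sd : sing d by apply/singZ/sing_base.
have Bsd : B s d = 0 by apply/formB_orthC; rewrite formBZl formB_base soi !mulr0.
have dk : d k 0 = 0 by rewrite !mxE eq_sym ik mulr0.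
have Bkd : B (sb k) d = 0 by rewrite formBZr base_orth ?mulr0 // eq_sym iok.
have Bokd : B (sb (opp k)) d = 0.
  by rewrite formBZr base_orth ?mulr0 ?ind_oppK.
have fsd : sing_pair s d by [].
have fkd : sing_pair (- sb k) d.
  by split; rewrite ?formBNl ?Bkd ?oppr0 //; apply/singN/sing_base.
have fokd : sing_pair (- z^b *: sb (opp k)) d.
  by split; rewrite ?formBZl ?Bokd ?mulr0 //; apply/singZ/sing_base.
have -> : g = (trans s d * trans (- sb k) d * trans (- z^b *: sb (opp k)) d)%g.
  apply: val_inj; rewrite gE rootE -/d [RHS]/= !val_trans //.
  have [[_ _ Bk] [_ _ Bok]] := (fkd, fokd).
  have Bskd : B (s - sb k) d = 0 by rewrite formBDl Bsd Bk addr0.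
  rewrite -!mulmxE (eichlerM _ _ (sing_formB sd) Bsd Bk).
  rewrite (eichlerM _ _ (sing_formB sd) Bskd Bok).
  congr eichler; first by rewrite /s scaleNr; apply/esym; rewrite addrAC !addrK.
  have Bs_k : B s (sb k) = z * l.
    by rewrite formBC formB_base sok /chi lt_kn mul1r barK.
  have Bs_ok : B (s - sb k) (sb (opp k)) = 0.
    apply: formB_orthC; rewrite formBDr formBNr !formB_base ind_oppK sk.
    by rewrite mxE !eqxx subrr.
  by rewrite formBNr formBZr Bs_k Bs_ok; field; exact: lam_neq0.
have ind_d v j : ind_hb j -> v j 0 != 0 -> d j 0 = 0 -> v i 0 = 0 -> indep v d.
  move=> hj vj dj vi a b r; have := rad_coord hj r; have := rad_coord hi r.
  have E i1 : (a *: v + b *: d) i1 0 = a * v i1 0 + b * d i1 0 by rewrite !mxE.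
  have di : d i 0 = t by rewrite !mxE !eqxx mulr1.
  rewrite !E dj vi di !mulr0 add0r addr0.
  move=> /eqP; rewrite mulf_eq0 (negPf t0) orbF => /eqP ->.
  by move=> /eqP; rewrite mulf_eq0 (negPf vj) orbF => /eqP ->.
apply: (@set_powerD _ X 8 4); first apply: (@set_powerD _ X 4 4).
- apply: power4 => //; apply: (ind_d s k) => //; rewrite ?sk ?oner_eq0 //.
  by rewrite sE ik iok (negPf i0) !mul0r !addr0.
- apply: power4 => //; apply: (ind_d _ k) => //; rewrite !mxE ?eqxx ?ik ?oppr0 //.
  by rewrite oppr_eq0 oner_eq0.
(* For z = 0 the third factor is the identity. *)
have [z0|z0] := eqVneq z 0.
  suff -> : trans (- z^b *: sb (opp k)) d = 1%g by exact: set_power4_1 XVg0.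
  apply: val_inj; rewrite val_trans // z0 rmorph0 oppr0 scale0r.
  exact: eichler0.
apply: power4 => //; apply: (ind_d _ (opp k)) => //; rewrite !mxE ?eqxx.
- by rewrite mulr1 oppr_eq0 bar_eq0.
- by rewrite opp_eq (negPf koi) mulr0.
- by rewrite iok mulr0.
Qed.

(** * Classes of full level *)

(** Working modulo the radical makes this a subgroup also when [mu = 0], where
    unitary maps may add multiples of [e_0] to the basis vectors. *)
Definition fixes_lines : set GL :=
  [set g | U g /\ forall i, ind_hb i -> exists x, rad (g ** sb i - x *: sb i)].

Lemma fixes_lines_subgroup : subgroup fixes_lines.
Proof.
split.
- split=> [|i _]; first exact: unitary1.
  by exists 1 => w; rewrite act1 scale1r subrr formB0l.
- move=> g h [Ug gL] [Uh hL]; split=> [|i hi]; first exact: unitaryM.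
  have [[x gx] [y hy]] := (gL i hi, hL i hi); exists (y * x).
  have := radD (rad_unitary Ug hy) (radZ y gx); congr (rad _).
  by rewrite actM !(mulmxDr, mulmxN) -scalemxAr scalerBr addrA subrK scalerA.
move=> g [Ug gL]; split=> [|i hi]; first exact: unitaryV.
have [x gx] := gL i hi; have x0 : x != 0.
  apply/eqP => x0; apply: (rad_base hi); apply: (unitary_rad Ug).
  by move: gx; rewrite x0 scale0r subr0.
exists x^-1; have := radZ (- x^-1) (rad_unitary (unitaryV Ug) gx).
congr (rad _); rewrite mulmxBr actK -scalemxAr scalerBr scalerA mulNr mulVf //.
by rewrite !scaleNr scale1r opprK addrC.
Qed.

(** If all these products vanished, every [r] in [C] would send each [e_j] to a
    multiple of itself plus a multiple of [e_0]; the latter is singular and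
    hence in the radical.  Then the group generated by [C] would fix all lines
    of basis vectors, whereas [T_ij(1)] sends [e_j] to [e_j + e_i]. *)
Lemma exists_offdiagonal (C : set GL) : (3 <= n)%N -> C `<=` U ->
    EU_rel n [set: K] (Delta H) `<=` generated C ->
  exists r i j, [/\ C r, ind_hb i, ind_hb j, i != opp j &
                    B (r ** sb j) (sb i) != 0].
Proof.
move=> hn CU subE; apply: contrapT => none.
have orth r i j : C r -> ind_hb i -> ind_hb j -> i != opp j ->
    B (r ** sb j) (sb i) = 0.
  move=> Cr hi hj ij; apply/eqP/negP => /negP Bn0.
  by apply: none; exists r, i, j.
have CL : C `<=` fixes_lines.
  move=> r Cr; split=> [|j hj]; first exact: CU.
  exists ((r ** sb j) j 0); set x := _ j 0.
  apply: sing_rad => [|i hi].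
    apply: singD; first exact/unitary_sing/sing_base/hj/CU.
      by apply/singN/singZ/sing_base.
    by rewrite formBNr formBZr orth ?mulr0 ?oppr0 // eq_sym opp_neq.
  rewrite [LHS]mxE [X in _ + X]mxE [X in - X]mxE [X in _ * X]mxE eqxx andbT.
  have [->|ij] := eqVneq i j.
    by rewrite mulr1 subrr.
  rewrite mulr0 subr0; have /formB_orthC/eqP : B (r ** sb j) (sb (opp i)) = 0.
    by apply: orth; rewrite ?ind_hb_opp // opp_eq ind_oppK.
  by rewrite formB_base ind_oppK mulf_eq0 (negPf (chi_neq0 _)) ?ind_hb_opp // => /eqP.
have [i [lt_in _ _ _ _]] := ind_avoid 0i 0i hn.
have [j [lt_jn ji joi _ _]] := ind_avoid i i hn.
have [hi hj] := (ind_hb_lt lt_in, ind_hb_lt lt_jn).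
have ij : sing_pair (sb i) (l *: sb (opp j)).
  split; [exact: sing_base | by apply/singZ/sing_base; rewrite ind_hb_opp |].
  rewrite formBZr base_orth ?mulr0 //.
  by rewrite (can_eq ind_oppK) eq_sym.
have gE : val (trans (sb i) (l *: sb (opp j))) = short_root H i j 1.
  by rewrite short_root1 // val_trans.
have : fixes_lines (trans (sb i) (l *: sb (opp j))).
  apply: (smallest_sub fixes_lines_subgroup CL); apply: subE.
  apply: sub_gen_smallest; apply: sub_gen_smallest; left; exists i, j, 1; split=> //.
  by rewrite hi hj eq_sym ji -opp_eq eq_sym.
case=> _ /(_ j hj)[x] /(_ (sb (opp i))).
have Bij : B (sb i) (sb j) = 0 by rewrite base_orth // eq_sym.
have Bji : B (sb j) (sb (opp i)) = 0 by rewrite base_orth // (can_eq ind_oppK).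
rewrite transE // Bij mulr0 scale0r subr0 formBDl formBNl formBDl !formBZl Bji.
rewrite base_opp formB_base ind_oppK mxE !eqxx /chi opp_lt opp_gt lt_in lt_jn.
rewrite ltnNge (ltnW lt_jn) bar_lam add0r !mulr1 mulr0 subr0 mulVf ?lam_neq0 //.
by rewrite rmorph1 => /eqP; rewrite oner_eq0.
Qed.

End Unitary.

Theorem corollary34 (K : fieldType) (H : hermFormField K) (n : nat)
    (hn : (3 <= n)%N) :
  (scn_sup (classes_of_level n [set: K] (Delta H)) (S_extra H n)
     <= 12%:E)%E.
Proof.
apply: scn_sup_le => // C [[x Ux CE] [_ subE _]].
have CU : C `<=` unitary H n.
  move=> y; rewrite -CE => -[g Ug <-].
  by apply: unitaryM; [apply: unitaryV | apply: unitaryM].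
have CJ y g : unitary H n g -> C y -> C (y ^ g)%g.
  move=> Ug; rewrite -CE => -[h Uh <-]; exists (h * g)%g; first exact: unitaryM.
  exact: conjgM.
have XV y : symm C y -> symm C y^-1%g.
  by case=> [Cy|[z Cz <-]]; [right; exists y | left; rewrite invgK].
have XJ y g : unitary H n g -> symm C y -> symm C (y ^ g)%g.
  move=> Ug [Cy|[z Cz <-]]; first by left; apply: CJ.
  by right; exists (z ^ g)%g; [apply: CJ | rewrite conjVg].
have [r [i [j [Cr hi hj ij Bij]]]] := exists_offdiagonal hn CU subE.
have Xr : symm C r by left.
have power4 := trans_power4 hn XV XJ (CU r Cr) Xr hi hj ij Bij.
by move=> g [/(extra_power12 hn Xr (XV r Xr) power4)].
Qed.
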